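(* Let $n\ge 1$ and let $E_0\in\mathbb{R}$ be such that $E_0$ is not an eigenvalue of $J_k$ for any $k=1,2,\dots,n$. Let $E_1^{(n)}<\dots<E_n^{(n)}$ be the eigenvalues of $J_n$. Then $$\#\{j : E_j^{(n)}>E_0\}=\#\{\ell\in\{1,\dots,n\} : \operatorname{sgn}(P_{\ell-1}(E_0))\ne\operatorname{sgn}(P_\ell(E_0))\}$$ and $$\#\{j : E_j^{(n)}<E_0\}=\#\{\ell\in\{1,\dots,n\} : \operatorname{sgn}(P_{\ell-1}(E_0))=\operatorname{sgn}(P_\ell(E_0))\}.$$
   Context: Let $a_1,a_2,\dots$ be nonzero real numbers and $b_1,b_2,\dots$ real numbers. For $n\ge1$, $J_n$ is the $n\times n$ real symmetric tridiagonal matrix with diagonal entries $b_1,\dots,b_n$, with $(k,k+1)$ and $(k+1,k)$ entries equal to $a_k$ for $1\le k\le n-1$, and all other entries $0$; its $n$ eigenvalues are real and simple. The polynomials $p_n(E)$, $n\ge0$, are defined by $p_{-1}\equiv0$, $p_0\equiv1$ and $a_{n+1}p_{n+1}(E)+(b_{n+1}-E)p_n(E)+a_np_{n-1}(E)=0$ for $n=0,1,2,\dots$ (the value of $a_0$ is irrelevant since $p_{-1}\equiv0$). Set $P_0=1$ and $P_n(E)=(a_1\cdots a_n)\,p_n(E)$, a monic polynomial of degree $n$. *)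

(* Defs.v *)
From HB Require Import structures.
From mathcomp Require Import all_boot all_order all_algebra.
From mathcomp Require Import reals.

Set Implicit Arguments.
Unset Strict Implicit.
Unset Printing Implicit Defensive.

Import Order.TTheory GRing.Theory Num.Theory.
Local Open Scope ring_scope.

(* The sequences a_1, a_2, ... and b_1, b_2, ... are functions on nat whose
   value at 0 plays no role.  Matrix indices i : 'I_n start at 0, so the
   index i stands for the row (or column) i.+1. *)
Definition jacobi_mx (R : realType) (a b : nat -> R) (n : nat) : 'M[R]_n :=
  \matrix_(i < n, j < n)
    if i == j then b i.+1
    else if j == i.+1 :> nat then a i.+1
    else if i == j.+1 :> nat then a j.+1
    else 0.

(* Solves a_(n+1) p_(n+1) + (b_(n+1) - 'X) p_n + a_n p_(n-1) = 0 for p_(n+1);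
   see jacobi_poly_rec0 and jacobi_poly_rec.  The inner match is p_(n-1),
   with p_(-1) = 0. *)
Fixpoint jacobi_poly (R : realType) (a b : nat -> R) (n : nat) : {poly R} :=
  if n is m.+1 then
    - (a m.+1)^-1 *: (((b m.+1)%:P - 'X) * jacobi_poly a b m
                      + a m *: (if m is l.+1 then jacobi_poly a b l else 0))
  else 1.

Definition monic_jacobi_poly (R : realType) (a b : nat -> R) (n : nat) :
    {poly R} :=
  (\prod_(1 <= k < n.+1) a k) *: jacobi_poly a b n.

Lemma jacobi_poly_rec0 (R : realType) (a b : nat -> R) (x : R) :
  a 1%N != 0 ->
  a 1%N * (jacobi_poly a b 1).[x]
  + (b 1%N - x) * (jacobi_poly a b 0).[x] = 0.
Proof.
move=> a1; rewrite /= scaler0 addr0 mulr1 hornerZ hornerD hornerN !hornerC hornerX.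
by rewrite mulr1 mulrA mulrN divff // mulN1r addNr.
Qed.

Lemma jacobi_poly_rec (R : realType) (a b : nat -> R) (n : nat) (x : R) :
  a n.+2 != 0 ->
  a n.+2 * (jacobi_poly a b n.+2).[x]
  + (b n.+2 - x) * (jacobi_poly a b n.+1).[x]
  + a n.+1 * (jacobi_poly a b n).[x] = 0.
Proof.
move=> an; have -> : jacobi_poly a b n.+2 =
    - (a n.+2)^-1 *: (((b n.+2)%:P - 'X) * jacobi_poly a b n.+1
                      + a n.+1 *: jacobi_poly a b n) by [].
move: (jacobi_poly a b n.+1) (jacobi_poly a b n) => q p.
rewrite hornerZ hornerD hornerM hornerZ hornerD hornerN hornerC hornerX.
by rewrite mulrA mulrN divff // mulN1r -addrA addNr.
Qed.

(* Main.v *)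
(* Write S = J_n - E_0.  In an orthogonal basis of eigenvectors of J_n, the
   quadratic form of S is diagonal with entries of the signs of E_j - E_0.  In
   the basis of the truncations w_k = (p_0(E_0), ..., p_k(E_0), 0, ..., 0),
   k < n, the recurrence makes w_k S vanish on coordinates 0, ..., k-1, so the
   form is diagonal too, with entries - a_(k+1) p_(k+1)(E_0) p_k(E_0), which
   have the sign of - P_k(E_0) P_(k+1)(E_0).  Sylvester's law of inertia
   equates the numbers of positive (and of negative) entries. *)

Require Import Defs.
From HB Require Import structures.
From mathcomp Require Import all_boot all_order all_algebra.
From mathcomp Require Import reals.
From mathcomp Require Import ring lra.

Set Implicit Arguments.
Unset Strict Implicit.
Unset Printing Implicit Defensive.

Import Order.TTheory GRing.Theory Num.Theory.
Local Open Scope ring_scope.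

(** * Sylvester's law of inertia *)

Lemma mulmx_diag_tr (R : comNzRingType) (n : nat) (d y : 'rV[R]_n) :
  (y *m diag_mx d *m y^T) 0 0 = \sum_i d 0 i * y 0 i ^+ 2.
Proof.
rewrite mxE; apply: eq_bigr => i _.
by rewrite mul_mx_diag !mxE expr2 mulrA [d 0 i * _]mulrC.
Qed.

(* If the left side were larger, a nonzero combination of the rows of [M]
   indexed by [e > 0] would vanish on [d > 0]; the form [diag_mx d] would be
   both positive and nonpositive on it. *)
Lemma leq_card_pos_diag (R : realFieldType) (n : nat) (M : 'M[R]_n)
    (d e : 'rV[R]_n) :
  M *m diag_mx d *m M^T = diag_mx e ->
  (#|[set i | (0 < e 0 i)%R]| <= #|[set i | (0 < d 0 i)%R]|)%N.
Proof.
move=> MdM; rewrite leqNgt; apply/negP => ltBA.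
set A := [set i | 0 < e 0 i] in ltBA; set B := [set i | 0 < d 0 i] in ltBA.
pose f (i : 'I_#|A|) := enum_val i; pose g (i : 'I_#|B|) := enum_val i.
(* This submatrix has more rows than columns, so its left kernel is nonzero. *)
have /rowV0Pn[c /sub_kermxP cN c0] : kermx (mxsub f g M) != 0.
  rewrite -mxrank_eq0 mxrank_ker subn_eq0 -ltnNge.
  exact: leq_ltn_trans (rank_leq_col _) ltBA.
pose y := c *m rowsub f M.
have yB j : 0 < d 0 j -> y 0 j = 0.
  move=> dj; have jB : j \in B by rewrite inE.
  have <- : (c *m mxsub f g M) 0 (enum_rank_in jB j) = 0 by rewrite cN mxE.
  rewrite !mxE; apply: eq_bigr => i _.
  by rewrite !mxE /g enum_rankK_in.
have yE : y *m diag_mx d *m y^T =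
    c *m diag_mx (\row_i e 0 (f i)) *m c^T.
  have -> : diag_mx (\row_i e 0 (f i)) = mxsub f f (diag_mx e).
    by apply/matrixP => i j; rewrite !mxE (inj_eq enum_val_inj).
  rewrite -MdM /y trmx_mul !mulmxA; congr (_ *m _).
  rewrite -!mulmxA; congr (_ *m _).
  by rewrite mxsub_mul -mulmx_colsub trmx_mxsub.
have /matrixP/(_ 0 0) := yE; rewrite !mulmx_diag_tr => yc.
have : \sum_i d 0 i * y 0 i ^+ 2 <= 0.
  apply: sumr_le0 => i _; case: (ltP 0 (d 0 i)) => di.
    by rewrite yB // expr0n mulr0.
  by rewrite mulr_le0_ge0 // sqr_ge0.
rewrite yc leNgt => /negP; apply.
have epos i : 0 < e 0 (f i) by have := enum_valP i; rewrite inE.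
have /rV0Pn[i ci] := c0.
rewrite (bigD1 i) //= ltr_pwDl //.
  by rewrite mxE mulr_gt0 // exprn_even_gt0.
by apply: sumr_ge0 => j _; rewrite mxE mulr_ge0 ?sqr_ge0 // ltW.
Qed.

Lemma sylvester_inertia (R : realFieldType) (n : nat) (S V W : 'M[R]_n)
    (d e : 'rV[R]_n) :
  V \in unitmx -> W \in unitmx ->
  V *m S *m V^T = diag_mx e -> W *m S *m W^T = diag_mx d ->
  #|[set i | 0 < e 0 i]| = #|[set i | 0 < d 0 i]|.
Proof.
have le (V' W' : 'M[R]_n) (d' e' : 'rV[R]_n) : W' \in unitmx ->
    V' *m S *m V'^T = diag_mx e' -> W' *m S *m W'^T = diag_mx d' ->
    (#|[set i | (0 < e' 0 i)%R]| <= #|[set i | (0 < d' 0 i)%R]|)%N.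
  (* [V' W'^-1] changes one basis into the other and so carries [diag_mx d'] to [diag_mx e']. *)
  move=> uW VSV WSW; apply: (@leq_card_pos_diag _ _ (V' *m invmx W')).
  rewrite -VSV -WSW trmx_mul trmx_inv !mulmxA mulmxKV //.
  by congr (_ *m _); rewrite -mulmxA mulmxV ?unitmx_tr // mulmx1.
move=> uV uW VSV WSW; apply/eqP.
by rewrite eqn_leq (le _ _ _ _ uW VSV) ?(le _ _ _ _ uV WSW).
Qed.

(** * The Jacobi matrix in the basis of truncations *)

Lemma jacobi_mx_sym (R : realType) (a b : nat -> R) (n : nat) :
  (jacobi_mx a b n)^T = jacobi_mx a b n.
Proof.
apply/matrixP => i j; rewrite !mxE [j == i]eq_sym.
case: eqP => [->//|_]; case: (eqVneq (i : nat) j.+1) => [ij|_]; last by [].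
by rewrite ij; case: eqP => // /eqP; rewrite ltn_eqF.
Qed.

(** The condition [f n = 0] lets the last column, which has no entry [a n] below the diagonal, obey
    the same three-term formula as the others. *)
Lemma sum_jacobi_mx (R : realType) (a b : nat -> R) (n : nat) (f : nat -> R)
    (j : 'I_n) : f n = 0 ->
  \sum_(i < n) f i * jacobi_mx a b n i j =
  (if (j : nat) is l.+1 then a j * f l else 0) + b j.+1 * f j + a j.+1 * f j.+1.
Proof.
move=> fn.
have pick (m : nat) (c : R) : (m < n)%N ->
    \sum_(i < n) (if i == m :> nat then c * f i else 0) = c * f m.
  by move=> mn; rewrite -big_mkcond (big_pred1 (Ordinal mn)).
have jn := ltn_ord j.
transitivity (\sum_(i < n)
   ((if j == i.+1 :> nat then a j * f i else 0) +
    (if i == j :> nat then b j.+1 * f i else 0) +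
    (if i == j.+1 :> nat then a j.+1 * f i else 0))).
  apply: eq_bigr => i _; rewrite mxE -val_eqE /=.
  case: (ltngtP i j) => [ij|ij|->].
  - rewrite [(i : nat) == j.+1]ltn_eqF ?ltnS 1?ltnW // !addr0.
    by case: eqP => [->|_]; rewrite ?mulr0 // mulrC.
  - rewrite [(j : nat) == i.+1]ltn_eqF ?ltnS 1?ltnW // !add0r.
    by case: eqP => _; rewrite ?mulr0 // mulrC.
  - by rewrite ltn_eqF // add0r addr0 mulrC.
rewrite !big_split /= pick //; congr (_ + _ + _).
  case: (nat_of_ord j) jn => [|l] ln; first by rewrite big1.
  by rewrite -(pick l (a l.+1)) ?(ltnW ln) //;
    apply: eq_bigr => i _; rewrite eqSS eq_sym.
have [j1n|nj1] := ltnP j.+1 n; first exact: pick.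
have -> : j.+1 = n by apply/eqP; rewrite eqn_leq jn.
by rewrite fn mulr0 big1 // => i _; rewrite ltn_eqF.
Qed.

(** Row [k] is the truncation [w_k]; the matrix is lower triangular with diagonal entries
    [p_k(x)]. *)
Definition jacobi_poly_mx (R : realType) (a b : nat -> R) (n : nat) (x : R) :
    'M[R]_n :=
  \matrix_(k < n, j < n) if (j <= k)%N then (jacobi_poly a b j).[x] else 0.

Lemma mul_jacobi_poly_mx (R : realType) (a b : nat -> R) (n : nat) (x : R)
    (k j : 'I_n) :
  (forall l, (1 <= l)%N -> a l != 0) -> (j <= k)%N ->
  (jacobi_poly_mx a b n x *m (jacobi_mx a b n - x%:M)) k j =
  - (a k.+1 * (jacobi_poly a b k.+1).[x]) *+ (j == k).
Proof.
move=> a_neq0 jk; rewrite mulmxBr mul_mx_scalar !mxE jk.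
pose p i := (jacobi_poly a b i).[x]; pose f i := if (i <= k)%N then p i else 0.
rewrite (eq_bigr (fun i : 'I_n => f i * jacobi_mx a b n i j)); last first.
  by move=> i _; rewrite mxE.
rewrite sum_jacobi_mx; last by rewrite /f leqNgt ltn_ord.
rewrite -!/(p _).
(* The recurrence at [j], with the untruncated [p j.+1]. The truncated sum differs from it by
   [a j.+1 * (f j.+1 - p j.+1)], which is zero unless [j = k]. *)
have rec : (if (j : nat) is l.+1 then a j * f l else 0) + b j.+1 * f j +
    a j.+1 * p j.+1 = x * p j.
  rewrite /f jk; case: (nat_of_ord j) jk => [|l] lk.
    by have := jacobi_poly_rec0 b x (a_neq0 1%N isT); rewrite -!/(p _); lra.
  rewrite (ltnW lk).
  by have := jacobi_poly_rec b x (a_neq0 l.+2 isT); rewrite -!/(p _); lra.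
rewrite -rec opprD addrACA subrr add0r.
have [->|njk] := eqVneq j k; first by rewrite /f ltnn mulr0 add0r mulr1n.
have jk1 : (j < k)%N by rewrite ltn_neqAle jk andbT; exact: njk.
by rewrite /f jk1 subrr.
Qed.

(** The last row [(p_0(x), ..., p_(n-1)(x))] times [J_n - x] is zero except for a last coordinate
    [- a_n p_n(x)]. If [p_n(x) = 0], this row is an eigenvector, nonzero because [p_0 = 1]. *)
Lemma jacobi_poly_neq0 (R : realType) (a b : nat -> R) (n : nat) (x : R) :
  (forall l, (1 <= l)%N -> a l != 0) ->
  (0 < n)%N -> ~~ eigenvalue (jacobi_mx a b n) x ->
  (jacobi_poly a b n).[x] != 0.
Proof.
move=> a_neq0; case: n => // n _; apply: contra => /eqP pn0.
apply/eigenvalueP; exists (row ord_max (jacobi_poly_mx a b n.+1 x)); last first.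
  by apply/rV0Pn; exists ord0; rewrite !mxE /= hornerC oner_eq0.
apply/eqP; rewrite -subr_eq0 -mul_mx_scalar -mulmxBr -row_mul.
apply/eqP/rowP => j; rewrite mxE mul_jacobi_poly_mx ?leq_ord // mxE.
by rewrite pn0 mulr0 oppr0 mul0rn.
Qed.

Lemma unitmx_jacobi_poly_mx (R : realType) (a b : nat -> R) (n : nat) (x : R) :
  (forall k, (k < n)%N -> (jacobi_poly a b k).[x] != 0) ->
  jacobi_poly_mx a b n x \in unitmx.
Proof.
move=> pn0; rewrite unitmxE det_trig.
  by rewrite unitfE; apply/prodf_neq0 => i _; rewrite mxE leqnn pn0.
by apply/is_trig_mxP => i j ij; rewrite mxE leqNgt ij.
Qed.

(** By symmetry the entries with [l <= k] suffice. There row [l] of [W] stops at coordinate [l],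
    while row [k] of [W S] vanishes before coordinate [k], so they can only meet when [k = l]. *)
Lemma jacobi_form_diag (R : realType) (a b : nat -> R) (n : nat) (x : R) :
  (forall l, (1 <= l)%N -> a l != 0) ->
  jacobi_poly_mx a b n x *m (jacobi_mx a b n - x%:M)
    *m (jacobi_poly_mx a b n x)^T =
  diag_mx (\row_(k < n) - (a k.+1 * (jacobi_poly a b k.+1).[x]
                           * (jacobi_poly a b k).[x])).
Proof.
move=> a_neq0; set W := jacobi_poly_mx a b n x; set S := _ - _.
set Q := _ *m _.
have low (k l : 'I_n) : (l <= k)%N ->
    Q k l = - (a k.+1 * (jacobi_poly a b k.+1).[x] * (jacobi_poly a b k).[x])
            *+ (k == l).
  move=> lk; rewrite mxE (bigD1 l) //= big1 => [|j jl].
    rewrite mul_jacobi_poly_mx // !mxE leqnn addr0 [l == k]eq_sym.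
    by have [->|_] := eqVneq k l; rewrite ?mulr1n ?mulNr ?mul0r.
  rewrite [W^T _ _]mxE [W _ _]mxE; case: leqP => [jl'|_]; last by rewrite mulr0.
  rewrite mul_jacobi_poly_mx ?(leq_trans jl') //.
  have /ltn_eqF jk : (j < k)%N.
    by rewrite (leq_trans _ lk) // ltn_neqAle jl' andbT.
  by rewrite -val_eqE jk mul0r.
have Qsym : Q^T = Q.
  rewrite /Q !trmx_mul trmxK [S^T]linearB /= jacobi_mx_sym tr_scalar_mx.
  by rewrite mulmxA.
apply/matrixP => k l; case: (leqP l k) => [lk|kl].
  by rewrite low // !mxE.
rewrite -Qsym mxE low ?(ltnW kl) // !mxE eq_sym.
by rewrite -val_eqE ltn_eqF.
Qed.

(** * The form in a basis of eigenvectors *)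

Lemma sym_eigen_diag (R : realFieldType) (n : nat) (S : 'M[R]_n)
    (E : 'I_n -> R) (x : R) :
  S^T = S -> injective E -> (forall i, eigenvalue S (E i)) ->
  exists (V : 'M[R]_n) (c : 'I_n -> R),
  [/\ V \in unitmx, forall i, 0 < c i &
      V *m (S - x%:M) *m V^T = diag_mx (\row_i ((E i - x) * c i))].
Proof.
move=> Ssym Einj Eeig.
have ex i : exists u : 'rV_n, u *m S = E i *: u /\ u != 0.
  by have /eigenvalueP[u] := Eeig i; exists u.
have [v vE] := fin_all_exists ex.
pose V := \matrix_i v i; pose c i := (v i *m (v i)^T) 0 0.
have VS : V *m S = diag_mx (\row_i E i) *m V.
  apply/row_matrixP => i; rewrite row_mul rowK (vE i).1.
  by apply/rowP => j; rewrite mul_diag_mx !mxE.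
have cpos i : 0 < c i.
  have /rV0Pn[j vj] := (vE i).2.
  rewrite /c mxE (bigD1 j) //= mxE ltr_pwDl -?expr2 ?exprn_even_gt0 //.
  by apply: sumr_ge0 => l _; rewrite mxE -expr2 sqr_ge0.
have G : V *m V^T = diag_mx (\row_i c i).
  set G := V *m V^T.
  (* Both sides equal [V S V^T], as [S] is symmetric. Entrywise this reads
     [(E i - E j) * G i j = 0], so distinct eigenvalues have orthogonal eigenvectors. *)
  have comm : diag_mx (\row_i E i) *m G = G *m diag_mx (\row_i E i).
    rewrite /G mulmxA -VS -{1}Ssym -!mulmxA -trmx_mul VS trmx_mul.
    by rewrite tr_diag_mx.
  apply/matrixP => i j.
  have [<-|nij] := eqVneq i j.
    by rewrite /G !mxE eqxx mulr1n /c mxE; apply: eq_bigr => k _; rewrite !mxE.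
  have /matrixP/(_ i j) := comm; rewrite mul_diag_mx mul_mx_diag !mxE.
  rewrite (negbTE nij) mulrC => /eqP; rewrite -subr_eq0 -mulrBr mulf_eq0.
  by rewrite subr_eq0 (inj_eq Einj) (negbTE nij) orbF => /eqP.
exists V, c; split => //.
  (* The Gram matrix is diagonal with positive entries, hence invertible, and so is its factor
     [V]. *)
  have : V *m V^T \in unitmx.
    rewrite G unitmxE det_diag unitfE; apply/prodf_neq0 => i _.
    by rewrite mxE gt_eqF.
  by rewrite unitmx_mul => /andP[].
rewrite mulmxBr mul_mx_scalar VS mulmxBl -scalemxAl -mulmxA G.
apply/matrixP => i j; rewrite mul_diag_mx !mxE mulrnAr mulrnAr -mulrnBl.
by rewrite mulrBl.
Qed.

(** * Sign changes and the final count *)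

Lemma neq_sgr (R : realDomainType) (u v : R) :
  u * v != 0 -> (Num.sg u != Num.sg v) = (u * v < 0).
Proof.
have N1 : -1 < 1 :> R by apply: lt_trans ltr01; rewrite ltrN10.
rewrite mulf_eq0 negb_or => /andP[].
case: (ltgtP u 0) => // u0 _; case: (ltgtP v 0) => // v0 _.
- by rewrite !ltr0_sg // eqxx nmulr_rlt0 // lt_gtF.
- by rewrite ltr0_sg // gtr0_sg // nmulr_rlt0 // v0 lt_eqF.
- by rewrite gtr0_sg // ltr0_sg // pmulr_rlt0 // v0 gt_eqF.
- by rewrite !gtr0_sg // eqxx pmulr_rlt0 // lt_gtF.
Qed.

Lemma neq_sg_monic_jacobi_poly (R : realType) (a b : nat -> R) (n : nat)
    (x : R) :
  (forall k, (1 <= k)%N -> a k != 0) ->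
  a n.+1 * (jacobi_poly a b n.+1).[x] * (jacobi_poly a b n).[x] != 0 ->
  (Num.sg (monic_jacobi_poly a b n).[x]
     != Num.sg (monic_jacobi_poly a b n.+1).[x]) =
  (a n.+1 * (jacobi_poly a b n.+1).[x] * (jacobi_poly a b n).[x] < 0).
Proof.
move=> a0; rewrite /monic_jacobi_poly.
move: (jacobi_poly a b n.+1) (jacobi_poly a b n) => p1 p0 t0.
rewrite !hornerZ [in X in _ != Num.sg (X * _)]big_nat_recr //=.
set q := \prod_(_ <= _ < _) _.
have q0 : q != 0.
  rewrite prodf_seq_neq0; apply/allP => k; rewrite mem_index_iota /=.
  by case/andP => k1 _; exact: a0.
(* With [q = a_1 ... a_n], the normalizing factors of [P_n] and [P_(n+1)] combine into
   [q ^+ 2 * a n.+1], so the sign of [q] does not matter. *)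
have prodE : q * p0.[x] * (q * a n.+1 * p1.[x]) =
    q ^+ 2 * (a n.+1 * p1.[x] * p0.[x]) by ring.
rewrite neq_sgr prodE; first by rewrite pmulr_rlt0 // exprn_even_gt0.
by rewrite mulf_eq0 sqrf_eq0 (negbTE q0) negbT ?(negbTE t0).
Qed.

Theorem theorem2p3 (R : realType) (a b : nat -> R)
    (ha : forall k : nat, (1 <= k)%N -> a k != 0)
    (n : nat) (hn : (1 <= n)%N) (E0 : R)
    (hE0 : forall k : nat, (1 <= k <= n)%N -> ~~ eigenvalue (jacobi_mx a b k) E0)
    (E : 'I_n -> R)
    (E_incr : forall i j : 'I_n, (i < j)%N -> E i < E j)
    (E_eig : forall x : R,
       eigenvalue (jacobi_mx a b n) x <-> exists j : 'I_n, x = E j) :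
  #|[set j : 'I_n | E0 < E j]| =
    #|[set l : 'I_n | Num.sg (monic_jacobi_poly a b l).[E0]
                      != Num.sg (monic_jacobi_poly a b l.+1).[E0]]|
  /\
  #|[set j : 'I_n | E j < E0]| =
    #|[set l : 'I_n | Num.sg (monic_jacobi_poly a b l).[E0]
                      == Num.sg (monic_jacobi_poly a b l.+1).[E0]]|.
Proof.
set d := \row_(k < n) - (a k.+1 * (jacobi_poly a b k.+1).[E0]
                          * (jacobi_poly a b k).[E0]).
(* The indices [k < n] make the truncations a basis; together with [k = n] they make every diagonal
   entry [d 0 l] nonzero. *)
have p0 k : (k <= n)%N -> (jacobi_poly a b k).[E0] != 0.
  case: k => [|k] kn; first by rewrite /= hornerC oner_eq0.
  by apply: jacobi_poly_neq0 => //; apply: hE0.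
have Einj : injective E.
  move=> i j; case: (ltngtP i j) => [/E_incr|/E_incr|/val_inj//] lt eqE.
  - by rewrite eqE ltxx in lt.
  - by rewrite eqE ltxx in lt.
have Eeig i : eigenvalue (jacobi_mx a b n) (E i) by apply/E_eig; exists i.
have [V [c [uV cpos VSV]]] :=
  sym_eigen_diag E0 (jacobi_mx_sym a b n) Einj Eeig.
have WSW := jacobi_form_diag b n E0 ha.
have uW : jacobi_poly_mx a b n E0 \in unitmx.
  by apply: unitmx_jacobi_poly_mx => k kn; apply/p0/ltnW.
have dE (l : 'I_n) : d 0 l != 0 /\
    (Num.sg (monic_jacobi_poly a b l).[E0]
       != Num.sg (monic_jacobi_poly a b l.+1).[E0]) = (0 < d 0 l).
  have dn0 : d 0 l != 0.
    by rewrite mxE oppr_eq0 !mulf_neq0 ?ha ?p0 // ltnW.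
  split=> //; move: dn0; rewrite mxE oppr_eq0 oppr_gt0.
  exact: neq_sg_monic_jacobi_poly.
split.
  have := sylvester_inertia uV uW VSV WSW.
  under eq_finset => i do rewrite mxE pmulr_lgt0 // subr_gt0.
  by move=> ->; apply: eq_card => l; rewrite !inE (dE l).2.
(* The inertia lemma counts positive entries, so negative ones are counted by applying it to [-S] in
   the same two bases. *)
have neg (U : 'M[R]_n) u : U *m (jacobi_mx a b n - E0%:M) *m U^T = diag_mx u ->
    U *m - (jacobi_mx a b n - E0%:M) *m U^T = diag_mx (- u).
  by move=> UU; rewrite mulmxN mulNmx UU linearN.
have := sylvester_inertia uV uW (neg _ _ VSV) (neg _ _ WSW).
under eq_finset => i do rewrite !mxE oppr_gt0 pmulr_llt0 // subr_lt0.
move=> ->; apply: eq_card => l; have [dn0 sgd] := dE l.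
(* Equal signs mean [d 0 l <= 0], which is strict since [d 0 l] is nonzero. *)
by rewrite !inE mxE oppr_gt0 -[RHS]negbK sgd -leNgt lt_neqAle dn0.
Qed.
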